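(* Let $n\in\mathbb{N}$, let $X$ and $Y$ be two rotation invariant spaces related to chirp functions on $\mathbb{R}^n$, let $\beta\in(0,n)$, and let $\boldsymbol{\alpha}=(\alpha_1,\ldots,\alpha_n)\in\mathbb{R}^n$ with $\alpha_k\notin\pi\mathbb{Z}$ for every $k\in\{1,\ldots,n\}$. Then the Riesz potential $I_\beta$ is bounded from $X$ to $Y$ if and only if the fractional Riesz potential related to chirp functions $I_\beta^{\boldsymbol{\alpha}}$ is bounded from $X$ to $Y$.
   Context: For $\boldsymbol{\alpha}=(\alpha_1,\ldots,\alpha_n)\in\mathbb{R}^n$ with $\alpha_k\notin\pi\mathbb{Z}$ for all $k$, the chirp function is $e_{\boldsymbol{\alpha}}(\boldsymbol{x}):=e^{2\pi i\sum_{k=1}^n a(\alpha_k)x_k^2}$, $a(\alpha_k):=\frac{\cot(\alpha_k)}{2}$. A Banach space $(X,\|\cdot\|_X)$ (of complex-valued measurable functions on $\mathbb{R}^n$, identified when equal a.e.) is called a rotation invariant space related to chirp functions if, for every $\boldsymbol{\alpha}\in\mathbb{R}^n$ with $\alpha_k\notin\pi\mathbb{Z}$ for all $k\in\{1,\ldots,n\}$ and every $f\in X$, one has $\|e_{\boldsymbol{\alpha}}f\|_X=\|f\|_X$ (in particular $e_{\boldsymbol{\alpha}}f\in X$). For $\beta\in(0,n)$, with $\gamma(\beta):=\pi^{n/2}2^\beta\Gamma(\beta/2)/\Gamma((n-\beta)/2)$, $$I_\beta(f)(\boldsymbol{x}):=\frac{1}{\gamma(\beta)}\int_{\mathbb{R}^n}\frac{f(\boldsymbol{y})}{|\boldsymbol{x}-\boldsymbol{y}|^{n-\beta}}\,d\boldsymbol{y},\qquad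 I_\beta^{\boldsymbol{\alpha}}(f)(\boldsymbol{x}):=\frac{1}{\gamma(\beta)}e_{-\boldsymbol{\alpha}}(\boldsymbol{x})\int_{\mathbb{R}^n}\frac{f(\boldsymbol{y})}{|\boldsymbol{x}-\boldsymbol{y}|^{n-\beta}}e_{\boldsymbol{\alpha}}(\boldsymbol{y})\,d\boldsymbol{y}.$$ An operator $T$ among these is bounded from $X$ to $Y$ if, for every $f\in X$, the defining integral converges absolutely for a.e. $\boldsymbol{x}$, $T(f)\in Y$, and there is a constant $C>0$ with $\|T(f)\|_Y\le C\|f\|_X$ for all $f\in X$. *)

(* Defs.v *)
From HB Require Import structures.
From mathcomp Require Import all_boot all_order all_algebra.
From mathcomp Require Import complex.
From mathcomp Require Import all_classical all_reals all_analysis.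

Set Implicit Arguments.
Unset Strict Implicit.
Unset Printing Implicit Defensive.

Import Order.TTheory GRing.Theory Num.Theory.
Import numFieldNormedType.Exports.

Local Open Scope classical_set_scope.
Local Open Scope ring_scope.
Local Open Scope complex_scope.

(* R^n with its Borel sigma-algebra: on tuples the library uses the one
   generated by the coordinate projections. *)
Notation euclid R n := (n.-tuple (measurableTypeR R)).

Section lebesgue_measure_euclid.
Context {R : realType}.

Definition cons_pt n (p : measurableTypeR R * euclid R n) : euclid R n.+1 :=
  [tuple of p.1 :: p.2].

Definition uncons_pt n (x : euclid R n.+1) : measurableTypeR R * euclid R n :=
  (thead x, [tuple of behead x]).

Lemma cons_ptK n : cancel (@cons_pt n) (@uncons_pt n).
Proof.
by case=> a t; congr (_, _) => //; apply/val_inj.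
Qed.

Lemma measurable_cons_pt n : measurable_fun [set: _] (@cons_pt n).
Proof. exact: measurable_cons. Qed.

Lemma measurable_uncons_pt n : measurable_fun [set: _] (@uncons_pt n).
Proof.
apply: measurable_fun_pair; first exact: measurable_tnth.
exact: measurable_behead.
Qed.

Section step.
Variables (n : nat) (mu : {sigma_finite_measure set (euclid R n) -> \bar R}).

Definition lebesgue_cons : set (euclid R n.+1) -> \bar R :=
  pushforward (lebesgue_measure \x mu)%E (@cons_pt n).

Let lebesgue_cons0 : lebesgue_cons set0 = 0%E.
Proof. by rewrite /lebesgue_cons /pushforward preimage_set0 measure0. Qed.

Let lebesgue_cons_ge0 A : (0 <= lebesgue_cons A)%E.
Proof. by rewrite /lebesgue_cons /pushforward measure_ge0. Qed.

Let lebesgue_cons_sigma_additive : semi_sigma_additive lebesgue_cons.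
Proof.
move=> F mF tF mUF; rewrite /lebesgue_cons /pushforward preimage_bigcup.
have mcF k : measurable (@cons_pt n @^-1` F k).
  by rewrite -[X in measurable X]setTI; exact: measurable_cons_pt.
apply: measure_semi_sigma_additive => //; last exact: bigcupT_measurable.
apply/trivIsetP => i j _ _ ij; rewrite -preimage_setI.
by move/trivIsetP : tF => /(_ _ _ _ _ ij) ->//; rewrite preimage_set0.
Qed.

HB.instance Definition _ := isMeasure.Build _ _ _ lebesgue_cons
  lebesgue_cons0 lebesgue_cons_ge0 lebesgue_cons_sigma_additive.

Let lebesgue_cons_sigma_finite : sigma_finite setT lebesgue_cons.
Proof.
have /sigma_finiteP[F [TF ndF Foo]] := sigma_finiteT (@lebesgue_measure R).
have /sigma_finiteP[G [TG ndG Goo]] := sigma_finiteT mu.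
exists (fun k => @uncons_pt n @^-1` (F k `*` G k)).
  rewrite -preimage_bigcup; apply/esym; rewrite -subTset => x _ /=.
  have [i _ Fi] : (\bigcup_k F k) (thead x) by rewrite -TF.
  have [j _ Gj] : (\bigcup_k G k) [tuple of behead x] by rewrite -TG.
  exists (maxn i j) => //; split => /=.
  - by move: Fi; exact/subsetPset/ndF/leq_maxl.
  - by move: Gj; exact/subsetPset/ndG/leq_maxr.
move=> k; have [mF Ffin] := Foo k; have [mG Gfin] := Goo k; split.
  by rewrite -[X in measurable X]setTI; apply: measurable_uncons_pt => //;
    exact: measurableX.
rewrite /lebesgue_cons /pushforward -comp_preimage.
rewrite (_ : _ @^-1` _ = F k `*` G k).
  by rewrite product_measure1E// lte_mul_pinfty// ge0_fin_numE.
by apply/funext => p; congr ((F k `*` G k) _); exact: cons_ptK.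
Qed.

HB.instance Definition _ := Measure_isSigmaFinite.Build _ _ _ lebesgue_cons
  lebesgue_cons_sigma_finite.

End step.

(* The library has Lebesgue measure on R and binary products only. Null sets are
   subsets of Borel null sets, so almost-everywhere statements are the same as
   for the completed measure. *)
Fixpoint lebesgue_euclid n : {sigma_finite_measure set (euclid R n) -> \bar R} :=
  match n with
  | 0 => \d_([tuple] : euclid R 0)
  | n'.+1 => lebesgue_cons (lebesgue_euclid n')
  end.

Lemma lebesgue_euclid_box n (A : 'I_n -> set (measurableTypeR R)) :
  (forall k, measurable (A k)) ->
  lebesgue_euclid n [set x : euclid R n | forall k, A k (tnth x k)] =
  (\prod_(k < n) lebesgue_measure (A k))%E.
Proof.
elim: n A => [|n IH] A mA.
  rewrite big_ord0 /= diracE mem_set //; by case.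
rewrite big_ord_recl /= /lebesgue_cons /pushforward.
rewrite -(IH (fun k => A (lift ord0 k))); last by move=> k; exact: mA.
pose B := [set x : euclid R n | forall k, A (lift ord0 k) (tnth x k)].
transitivity ((lebesgue_measure \x lebesgue_euclid n)%E (A ord0 `*` B)).
  congr (product_measure1 _ _ _).
  apply/seteqP; split=> [[a t] /= AB|[a t] /= [Aa Bt] k].
    split; first by have := AB ord0; rewrite tnth0.
    by move=> k; have := AB (lift ord0 k); rewrite tnthS.
  case: (unliftP ord0 k) => [j|] ->; last by rewrite tnth0.
  by rewrite tnthS; exact: Bt.
apply: product_measure1E; first exact: mA.
rewrite (_ : B = \bigcap_(k in [set: 'I_n]) (@tnth n (measurableTypeR R) ^~ k @^-1` A (lift ord0 k))).
  apply: fin_bigcap_measurable => // k _.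
  by rewrite -[X in measurable X]setTI; exact: measurable_tnth.
by apply/seteqP; split=> x /= h k => [_|]; exact: h.
Qed.

End lebesgue_measure_euclid.

Section complex_integral.
Context d (T : measurableType d) (R : realType).
Variable mu : {measure set T -> \bar R}.
Implicit Type f : T -> R[i].

Definition cmeasurable f :=
  measurable_fun [set: T] (fun x => complex.Re (f x)) /\
  measurable_fun [set: T] (fun x => complex.Im (f x)).

Definition cintegrable f :=
  cmeasurable f /\ (\int[mu]_x (Normc.normc (f x))%:E < +oo)%E.

Definition cintegral f : R[i] :=
  (\int[mu]_x complex.Re (f x)) +i* (\int[mu]_x complex.Im (f x)).

End complex_integral.

Section chirp.
Context {R : realType} {n : nat}.
Implicit Types alpha x : euclid R n.

Definition expi (t : R) : R[i] := cos t +i* sin t.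

Definition chirp_param alpha :=
  forall (k : 'I_n) (m : int), tnth alpha k <> m%:~R * pi.

Definition half_cot (t : R) : R := (cos t / sin t) / 2.

Definition chirp alpha x : R[i] :=
  expi (2 * pi * \sum_(k < n) half_cot (tnth alpha k) * tnth x k ^+ 2).

Definition opp_pt alpha : euclid R n := [tuple - tnth alpha k | k < n].

End chirp.

Section function_spaces.
Context {R : realType} {n : nat}.
Local Notation mu := (@lebesgue_euclid R n).

(* A complex Banach space of a.e. classes of measurable functions on R^n, i.e.
   a Banach space with an injective linear map into the space of such classes.
   The map is presented by representatives: rep f is a Borel function in the
   class of f (every Lebesgue measurable class contains one), so linearity and
   injectivity hold up to a.e. equality. *)
Record function_space := FunctionSpace {
  space :> completeNormedModType R[i];
  rep : space -> euclid R n -> R[i];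
  rep_measurable : forall f, cmeasurable (rep f);
  rep_linear : forall (a : R[i]) (f g : space),
    {ae mu, forall x, rep (a *: f + g) x = a * rep f x + rep g x};
  rep_inj : forall f g : space, {ae mu, forall x, rep f x = rep g x} -> f = g
}.

(* "The function h belongs to X" is [exists g : X, represents g h]; the norm of
   h in X is then the norm of g, which is unique by rep_inj. *)
Definition represents (X : function_space) (g : X) (h : euclid R n -> R[i]) :=
  {ae mu, forall x, rep g x = h x}.

Definition rotation_invariant (X : function_space) :=
  forall alpha : euclid R n, chirp_param alpha -> forall f : X,
  exists2 g : X, represents g (fun x => chirp alpha x * rep f x) & `|g| = `|f|.

(* Boundedness of T f x = c x * \int K f x y dy from X to Y, where K is the
   integrand. Norms are R[i]-valued (and real), as scalars are complex. *)
Definition bounded_integral_operator (X Y : function_space)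
    (K : (euclid R n -> R[i]) -> euclid R n -> euclid R n -> R[i])
    (T : (euclid R n -> R[i]) -> euclid R n -> R[i]) :=
  [/\ forall f : X, {ae mu, forall x, cintegrable mu (K (rep f) x)},
      forall f : X, exists g : Y, represents g (T (rep f)) &
      exists2 C : R, 0 < C & forall (f : X) (g : Y),
        represents g (T (rep f)) -> `|g| <= C%:C * `|f|].

End function_spaces.
Arguments function_space : clear implicits.

Section riesz.
Context {R : realType} {n : nat}.
Local Notation mu := (@lebesgue_euclid R n).
Implicit Types (b : R) (x y alpha : euclid R n) (f : euclid R n -> R[i]).

Definition euclid_dist x y : R :=
  Num.sqrt (\sum_(k < n) (tnth x k - tnth y k) ^+ 2).

Definition Gamma (s : R) : R :=
  \int[lebesgue_measure]_(t in `]0, +oo[) (t `^ (s - 1) * expR (- t)).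

Definition riesz_const b : R :=
  pi `^ (n%:R / 2) * 2 `^ b * Gamma (b / 2) / Gamma ((n%:R - b) / 2).

Definition riesz_integrand b f x y : R[i] :=
  f y / (euclid_dist x y `^ (n%:R - b))%:C.

Definition riesz b f x : R[i] :=
  (riesz_const b)^-1%:C * cintegral mu (riesz_integrand b f x).

Definition frac_riesz_integrand b alpha f x y : R[i] :=
  f y / (euclid_dist x y `^ (n%:R - b))%:C * chirp alpha y.

Definition frac_riesz b alpha f x : R[i] :=
  (riesz_const b)^-1%:C * chirp (opp_pt alpha) x *
  cintegral mu (frac_riesz_integrand b alpha f x).

End riesz.

(* Main.v *)
Require Import Defs.
From mathcomp Require Import all_boot all_order all_algebra.
From mathcomp Require Import complex.
From mathcomp Require Import all_classical all_reals all_analysis.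
From mathcomp Require Import measurable_realfun.

(** Multiplication by a chirp is an isometry of a rotation invariant space onto
    itself, with inverse the multiplication by the conjugate chirp [e_(-alpha)].
    The fractional Riesz potential is the Riesz potential conjugated by it:
      [I_beta^alpha f = e_(-alpha) I_beta (e_alpha f)],  and conversely
      [I_beta f = e_alpha I_beta^alpha (e_(-alpha) f)].
    So either operator is the other one preceded by an isometry of [X] and
    followed by an isometry of [Y], and boundedness passes both ways with the
    same constant. [bounded_conj_chirp] is this transfer for an arbitrary pair
    of operators related in this way; the theorem applies it twice, with [alpha]
    and with [-alpha].

    A space only determines its elements up to null sets: the class of
    [e_alpha f] has some measurable representative, which need not be the
    pointwise product. The transfer therefore asks that the operator, and the
    absolute convergence of its integral at each single point [x], depend only
    on the a.e. class of the argument ([ae_stable]). For the two potentials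
    ([ae_stable_riesz], [ae_stable_frac_riesz]) this holds because [x] is fixed
    and the integrands are then measurable functions of [y] that agree a.e. *)

Set Implicit Arguments.
Unset Strict Implicit.
Unset Printing Implicit Defensive.

Import Order.TTheory GRing.Theory Num.Theory.
Import numFieldNormedType.Exports.

Local Open Scope classical_set_scope.
Local Open Scope ring_scope.

(** * Measurability and integration of complex-valued functions *)

Section complex_integral_ae.
Context d (T : measurableType d) (R : realType).
Variable mu : {measure set T -> \bar R}.
Implicit Types f g : T -> R[i].

Lemma cmeasurableM f g :
  cmeasurable f -> cmeasurable g -> cmeasurable (fun x => f x * g x).
Proof.
move=> [mRf mIf] [mRg mIg]; split.
- apply: (eq_measurable_fun (fun x => complex.Re (f x) * complex.Re (g x) -
    complex.Im (f x) * complex.Im (g x))).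
    by move=> x _; case: (f x) (g x) => [? ?] [? ?].
  by apply: measurable_funB; exact: measurable_funM.
- apply: (eq_measurable_fun (fun x => complex.Re (f x) * complex.Im (g x) +
    complex.Im (f x) * complex.Re (g x))).
    by move=> x _; case: (f x) (g x) => [? ?] [? ?].
  by apply: measurable_funD; exact: measurable_funM.
Qed.

Lemma cmeasurable_real (u : T -> R) :
  measurable_fun setT u -> cmeasurable (fun x => (u x)%:C%C).
Proof. by move=> mfu; split => //=; exact: measurable_cst. Qed.

Lemma measurable_sqrt : measurable_fun [set: R] (@Num.sqrt R).
Proof. by apply: continuous_measurable_fun; exact: sqrt_continuous. Qed.

Lemma measurable_normc f : cmeasurable f ->
  measurable_fun setT (fun x => Normc.normc (f x)).
Proof.
move=> [mR mI].
apply: (eq_measurable_fun (fun x =>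
    Num.sqrt (complex.Re (f x) ^+ 2 + complex.Im (f x) ^+ 2))).
  by move=> x _; case: (f x).
apply: measurableT_comp; first exact: measurable_sqrt.
by apply: measurable_funD; exact: measurable_funX.
Qed.

Lemma ae_eq_Rintegral (u v : T -> R) :
  measurable_fun setT u -> measurable_fun setT v ->
  {ae mu, forall x, u x = v x} -> (\int[mu]_x u x = \int[mu]_x v x)%R.
Proof.
move=> mfu mfv uv; congr fine; apply: ae_eq_integral => //.
- exact/measurable_EFinP.
- exact/measurable_EFinP.
by apply: filterS uv => x /= ->.
Qed.

Lemma cintegral_ae_eq f g : cmeasurable f -> cmeasurable g ->
  {ae mu, forall x, f x = g x} -> cintegral mu f = cintegral mu g.
Proof.
move=> [mRf mIf] [mRg mIg] fg; congr (_ +i* _)%C;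
  by apply: ae_eq_Rintegral => //; apply: filterS fg => x /= ->.
Qed.

Lemma cintegrable_ae_eq f g : cmeasurable g ->
  {ae mu, forall x, f x = g x} -> cintegrable mu f -> cintegrable mu g.
Proof.
move=> mg fg [mf intf]; split => //.
rewrite (_ : (\int[mu]_x _)%E = (\int[mu]_x (Normc.normc (f x))%:E)%E) //.
apply: ae_eq_integral => //.
- exact/measurable_EFinP/measurable_normc.
- exact/measurable_EFinP/measurable_normc.
by apply: filterS fg => x /= ->.
Qed.

End complex_integral_ae.

(** * Chirps *)

Section chirp_theory.
Context {R : realType} {n : nat}.
Implicit Types alpha x : euclid R n.

Lemma opp_ptK : involutive (@opp_pt R n).
Proof.
by move=> a; apply: eq_from_tnth => k; rewrite !tnth_mktuple opprK.
Qed.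

Lemma chirp_param_opp alpha : chirp_param alpha -> chirp_param (opp_pt alpha).
Proof.
move=> ha k m; rewrite tnth_mktuple => akm; apply: (ha k (- m)).
by rewrite rmorphN mulNr -akm opprK.
Qed.

(** The half-cotangent is odd, so the phases of the two chirps are opposite. *)
Lemma chirp_oppK alpha x : chirp (opp_pt alpha) x * chirp alpha x = 1.
Proof.
rewrite /chirp; set t := (X in _ * expi X).
have -> : 2 * pi * \sum_(k < n) half_cot (tnth (opp_pt alpha) k) * tnth x k ^+ 2
    = - t.
  rewrite /t -mulrN -sumrN; congr (_ * _); apply: eq_bigr => k _.
  by rewrite tnth_mktuple /half_cot sinN cosN invrN mulrN !mulNr.
rewrite /expi sinN cosN; apply/eqP; rewrite eq_complex /=; apply/andP; split.
  by rewrite mulNr opprK -!expr2 cos2Dsin2.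
by rewrite mulNr mulrC subrr.
Qed.

Lemma cmeasurable_chirp alpha : cmeasurable (chirp alpha).
Proof.
have mphase : measurable_fun [set: euclid R n]
    (fun x => 2 * pi * \sum_(k < n) half_cot (tnth alpha k) * tnth x k ^+ 2).
  apply: measurable_funM; first exact: measurable_cst.
  apply: measurable_sum => k; apply: measurable_funM => //.
  by apply: measurable_funX; exact: measurable_tnth.
split => /=; apply: (measurableT_comp _ mphase);
  apply: continuous_measurable_fun.
- exact: continuous_cos.
- exact: continuous_sin.
Qed.

End chirp_theory.

(** * Conjugating an integral operator by a chirp *)

Section conjugation.
Context {R : realType} {n : nat}.
Local Notation mu := (@lebesgue_euclid R n).
Local Notation fct := (euclid R n -> R[i]).
Implicit Types (u v : fct) (x : euclid R n).

(** What lets an operator given by a formula on functions act on a.e. classes.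
    Both conditions are required at every [x], not merely at almost every one. *)
Definition ae_stable (K : fct -> euclid R n -> fct) (T : fct -> fct) :=
  forall u v, cmeasurable u -> cmeasurable v ->
  {ae mu, forall y, u y = v y} -> forall x,
  (cintegrable mu (K u x) -> cintegrable mu (K v x)) /\ T u x = T v x.

(** [T'] is [T] preceded by an isometry of [X] and followed by an isometry
    of [Y], hence it satisfies the same norm bound. *)
Lemma bounded_conj_chirp (X Y : function_space R n) (alpha : euclid R n)
    (K K' : fct -> euclid R n -> fct) (T T' : fct -> fct) :
  rotation_invariant X -> rotation_invariant Y -> chirp_param alpha ->
  ae_stable K T ->
  (forall u, K' u = K (fun y => chirp alpha y * u y)) ->
  (forall u x, T' u x =
     chirp (opp_pt alpha) x * T (fun y => chirp alpha y * u y) x) ->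
  bounded_integral_operator X Y K T -> bounded_integral_operator X Y K' T'.
Proof.
move=> hX hY ha stab K'E T'E [intK memT [C C0 leC]].
have stabf (f g : X) : represents g (fun y => chirp alpha y * rep f y) ->
    forall x, (cintegrable mu (K (rep g) x) -> cintegrable mu (K' (rep f) x)) /\
      T' (rep f) x = chirp (opp_pt alpha) x * T (rep g) x.
  move=> gf x; rewrite K'E T'E.
  have mg : cmeasurable (rep g) by exact: rep_measurable.
  have mef : cmeasurable (fun y => chirp alpha y * rep f y).
    by apply: cmeasurableM; [exact: cmeasurable_chirp | exact: rep_measurable].
  by have [? ->] := stab _ _ mg mef gf x.
have image (f : X) : exists2 g' : Y, represents g' (T' (rep f)) &
    `|g'| <= (C%:C)%C * `|f|.
  have [g gf normg] := hX _ ha f.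
  have [h hg] := memT g.
  have [h' h'h normh'] := hY _ (chirp_param_opp ha) h.
  exists h'; last by rewrite normh' -normg; exact: leC.
  apply: filterS2 h'h hg => x -> ->.
  by have [_ ->] := stabf _ _ gf x.
split=> [f|f|].
- have [g gf _] := hX _ ha f.
  by apply: filterS (intK g) => x; have [] := stabf _ _ gf x.
- by have [g' ? _] := image f; exists g'.
- exists C => // f g gT.
  (* The representative at hand is the one built above, by injectivity of rep. *)
  have [g' g'T le_g'] := image f.
  suff -> : g = g' by [].
  by apply: rep_inj; apply: filterS2 gT g'T => x -> ->.
Qed.

End conjugation.

(** * The Riesz potentials *)

Section riesz_theory.
Context {R : realType} {n : nat}.
Implicit Types (b : R) (x y alpha : euclid R n) (u v : euclid R n -> R[i]).

Lemma measurable_euclid_dist x : measurable_fun setT (euclid_dist x).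
Proof.
apply: measurableT_comp; first exact: measurable_sqrt.
apply: measurable_sum => k; apply: measurable_funX.
apply: measurable_funB; first exact: measurable_cst.
exact: measurable_tnth.
Qed.

Lemma cmeasurable_riesz_integrand b u x :
  cmeasurable u -> cmeasurable (riesz_integrand b u x).
Proof.
move=> mfu.
have -> : riesz_integrand b u x =
    fun y => u y * ((euclid_dist x y `^ (- (n%:R - b)))%:C)%C.
  by apply/funext => y; rewrite /riesz_integrand powRN fmorphV.
apply: cmeasurableM => //; apply: cmeasurable_real.
exact: (measurableT_comp (measurable_powR _) (measurable_euclid_dist x)).
Qed.

Lemma ae_stable_riesz b : ae_stable (@riesz_integrand R n b) (riesz b).
Proof.
move=> u v mfu mv uv x.
have muK := cmeasurable_riesz_integrand b x mfu.
have mvK := cmeasurable_riesz_integrand b x mv.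
have uvK : {ae @lebesgue_euclid R n, forall y,
    riesz_integrand b u x y = riesz_integrand b v x y}.
  by apply: filterS uv => y; rewrite /riesz_integrand => ->.
split; first exact: cintegrable_ae_eq.
by rewrite /riesz (cintegral_ae_eq muK mvK uvK).
Qed.

Lemma frac_riesz_integrandE b alpha u :
  frac_riesz_integrand b alpha u =
  riesz_integrand b (fun y => chirp alpha y * u y).
Proof.
apply/funext => x; apply/funext => y.
by rewrite /frac_riesz_integrand /riesz_integrand mulrC mulrA.
Qed.

Lemma frac_rieszE b alpha u x :
  frac_riesz b alpha u x =
  chirp (opp_pt alpha) x * riesz b (fun y => chirp alpha y * u y) x.
Proof. by rewrite /frac_riesz /riesz frac_riesz_integrandE -mulrA mulrCA. Qed.

Lemma ae_stable_frac_riesz b alpha :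
  ae_stable (frac_riesz_integrand b alpha) (frac_riesz b alpha).
Proof.
move=> u v mfu mv uv x; rewrite !frac_riesz_integrandE !frac_rieszE.
have mchirp w (mw : cmeasurable w) : cmeasurable (fun y => chirp alpha y * w y).
  by apply: cmeasurableM => //; exact: cmeasurable_chirp.
have [|? ->] // := ae_stable_riesz b (mchirp _ mfu) (mchirp _ mv) _ x.
by apply: filterS uv => y ->.
Qed.

End riesz_theory.

Theorem theorem2p20 (R : realType) (n : nat) (X Y : function_space R n)
    (hX : rotation_invariant X) (hY : rotation_invariant Y)
    (b : R) (hb : 0 < b < n%:R)
    (alpha : euclid R n) (halpha : chirp_param alpha) :
  bounded_integral_operator X Y (riesz_integrand b) (riesz b) <->
  bounded_integral_operator X Y
    (frac_riesz_integrand b alpha) (frac_riesz b alpha).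
Proof.
split.
  apply: (bounded_conj_chirp hX hY halpha (ae_stable_riesz b)).
    exact: frac_riesz_integrandE.
  exact: frac_rieszE.
have chirpK u : (fun y => chirp alpha y * (chirp (opp_pt alpha) y * u y)) = u.
  by apply/funext => y; rewrite mulrCA mulrA chirp_oppK mul1r.
apply: (bounded_conj_chirp hX hY (chirp_param_opp halpha)
  (@ae_stable_frac_riesz _ _ b alpha)) => [u|u x].
  by rewrite frac_riesz_integrandE chirpK.
rewrite frac_rieszE chirpK opp_ptK mulrA.
by rewrite [chirp alpha x * _]mulrC chirp_oppK mul1r.
Qed.
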